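(* Let $S$ be a non-empty set and let $F:\ell_+\to\mathbb{R}_+$ be increasing and subadditive and vanish only at $\mathbf{0}$. Then a sequence $(d_i)_{i\in\mathbb{N}}$ of pseudometrics on $S$ induces another pseudometric $d$ by $$d(x,y):=F(d_0(x,y)),\qquad d_0(x,y):=(d_i(x,y))_{i\in\mathbb{N}},$$ which is a metric if and only if any $x,y\in S$ with $d_0(x,y)=\mathbf{0}$ agree, and the topology induced by $d$ is finer than that of $d_i$ for each $i\in\mathbb{N}$. Moreover, if $$\lim_{v\to0}F\bigg(\sum_{i=1}^jv_ie_i\bigg)=0\quad\text{for all }j\in\mathbb{N}\quad\text{and}\quad\lim_{j\uparrow\infty}\sup_{x,y\in S}F\bigg(\sum_{i=j}^\infty d_i(x,y)e_i\bigg)=0,$$ then the following four assertions hold: (i) A sequence in $S$ converges relative to $d$ if and only if there is a point in $S$ to which it converges relative to $d_i$ for any $i\in\mathbb{N}$. (ii) A sequence in $S$ is Cauchy relative to $d$ if and only if it is Cauchy with respect to $d_i$ for all $i\in\mathbb{N}$. (iii) If for any sequence $(x_n)_{n\in\mathbb{N}}$ in $S$ converging relative to $d_i$ for each $i\in\mathbb{N}$ there is $x\in S$ such that $\lim_{n\uparrow\infty}d_i(x_n,x)=0$ for all $i\in\mathbb{N}$, then the completeness of $d_i$ for each $i\in\mathbb{N}$ implies that of $d$. (iv) If $d$ turns $S$ into a separable space, then so does $d_i$ for each $i\in\mathbb{N}$ and there is a countable set that is dense with respect to $d_i$ for any $i\in\mathbb{N}$. Conversely, if the topology induced by $d_{i+1}$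 is finer than that of $d_i$ for each $i\in\mathbb{N}$, then $S$ equipped with $d$ is separable as soon as it is separable if endowed with $d_i$ for any $i\in\mathbb{N}$.
   Context: $\mathbb{R}_+=[0,\infty)$. $\ell_+$ is the convex cone of all sequences $a=(a_i)_{i\in\mathbb{N}}$ in $\mathbb{R}_+$, $e_i$ is the $i$th canonical basis vector in $\ell_+$, $\mathbf{0}:=(0)_{i\in\mathbb{N}}$, and $\sum_{i=j}^\infty a_ie_i$ denotes the sequence whose first $j-1$ entries are $0$ and whose $i$th entry is $a_i$ for $i\ge j$. $F$ is increasing if $F(a)\le F(b)$ for any $a,b\in\ell_+$ with $a_i\le b_i$ for each $i\in\mathbb{N}$. In the limit $v\to0$, $v=(v_1,\dots,v_j)$ ranges over $\mathbb{R}_+^j$. ''Finer'' is meant in the non-strict sense. *)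

(* Defs.v *)
From HB Require Import structures.
From mathcomp Require Import all_boot all_order all_algebra.
From mathcomp Require Import all_classical all_reals all_analysis.

Set Implicit Arguments.
Unset Strict Implicit.
Unset Printing Implicit Defensive.

Import Order.TTheory GRing.Theory Num.Theory.
Import numFieldNormedType.Exports.

Local Open Scope classical_set_scope.
Local Open Scope ring_scope.

Record pseudometric (R : realType) (S : Type) := Pseudometric {
  pdist :> S -> S -> R;
  pdist_ge0 : forall x y, 0 <= pdist x y;
  pdistxx : forall x, pdist x x = 0;
  pdist_sym : forall x y, pdist x y = pdist y x;
  pdist_triangle : forall y x z, pdist x z <= pdist x y + pdist y z
}.

Definition is_metric (R : realType) (S : Type) (d : pseudometric R S) : Prop :=
  forall x y : S, d x y = 0 -> x = y.

(* The set S carries several pseudometrics at once: pmspace d is a copy of S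
   on which the canonical pseudoMetricType structure, hence the uniformity and
   the topology, is the one whose balls are the open d-balls. *)
Definition pmspace (R : realType) (S : Type) (d : pseudometric R S) : Type := S.

Section pmspace_structure.
Context (R : realType) (S : Type) (d : pseudometric R S).

HB.instance Definition _ := gen_eqMixin (pmspace d).
HB.instance Definition _ := gen_choiceMixin (pmspace d).

Let pmball (x : pmspace d) (e : R) : set (pmspace d) := [set y | d x y < e].

Let ent : set_system (pmspace d * pmspace d) := entourage_ pmball.

Let pmnbhs (x : pmspace d) : set_system (pmspace d) := nbhs_ ent x.

HB.instance Definition _ := hasNbhs.Build (pmspace d) pmnbhs.

Let nbhsE : nbhs = nbhs_ ent. Proof. by []. Qed.

Let pmball_center (x : pmspace d) (e : R) : 0 < e -> pmball x e x.
Proof. by move=> e0; rewrite /pmball/= pdistxx. Qed.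

Let pmball_sym (x y : pmspace d) (e : R) : pmball x e y -> pmball y e x.
Proof. by rewrite /pmball/= pdist_sym. Qed.

Let pmball_triangle (x y z : pmspace d) (e1 e2 : R) :
  pmball x e1 y -> pmball y e2 z -> pmball x (e1 + e2) z.
Proof.
rewrite /pmball/= => xy yz.
by rewrite (le_lt_trans (pdist_triangle d y x z))// ltrD.
Qed.

Let entE : ent = entourage_ pmball. Proof. by []. Qed.

HB.instance Definition _ := @Nbhs_isPseudoMetric.Build R (pmspace d)
  ent nbhsE pmball pmball_center pmball_sym pmball_triangle entE.

Lemma pmspace_ballE (x : pmspace d) (e : R) : ball x e = [set y | d x y < e].
Proof. by []. Qed.

End pmspace_structure.

Definition finer_topology (R : realType) (S : Type)
    (d d' : pseudometric R S) : Prop :=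
  forall U : set S, open (U : set (pmspace d')) -> open (U : set (pmspace d)).

Definition converges_to (R : realType) (S : Type) (d : pseudometric R S)
    (u : nat -> S) (x : S) : Prop :=
  (u : nat -> pmspace d) @ \oo --> (x : pmspace d).

Definition converges (R : realType) (S : Type) (d : pseudometric R S)
    (u : nat -> S) : Prop :=
  exists x : S, converges_to d u x.

Definition cauchy_seq (R : realType) (S : Type) (d : pseudometric R S)
    (u : nat -> S) : Prop :=
  cauchy ((u : nat -> pmspace d) @ \oo).

Definition complete_pm (R : realType) (S : Type)
    (d : pseudometric R S) : Prop :=
  forall u : nat -> S, cauchy_seq d u -> converges d u.

Definition dense_in (R : realType) (S : Type) (d : pseudometric R S)
    (A : set S) : Prop :=
  dense (A : set (pmspace d)).

Definition separable (R : realType) (S : Type) (d : pseudometric R S) : Prop :=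
  exists2 A : set S, countable A & dense_in d A.

(* Sequences are indexed from 0: the entry a i is the (i+1)st entry. *)
Definition ell_plus (R : realType) : set (R^nat) :=
  [set a | forall i, 0 <= a i].

Definition basis_seq (R : realType) (i : nat) : R^nat :=
  fun k => (k == i)%:R.

Definition fin_seq (R : realType) (j : nat) (v : 'rV[R]_j) : R^nat :=
  fun k => \sum_(i < j) v 0 i * basis_seq R i k.

(* tail_seq j a is the sum of the a i e_i over i >= j *)
Definition tail_seq (R : realType) (j : nat) (a : R^nat) : R^nat :=
  fun k => if (j <= k)%N then a k else 0.

Definition nonneg_orthant (R : realType) (j : nat) : set ('rV[R]_j) :=
  [set v | forall i, 0 <= v 0 i].

(* F is a map from ell_plus to R_+: it is only constrained on ell_plus, and its
   values elsewhere are irrelevant. *)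
Definition nonneg_on_ell (R : realType) (F : R^nat -> R) : Prop :=
  forall a, ell_plus a -> 0 <= F a.

Definition increasing_on_ell (R : realType) (F : R^nat -> R) : Prop :=
  forall a b, ell_plus a -> ell_plus b ->
    (forall i, a i <= b i) -> F a <= F b.

Definition subadditive_on_ell (R : realType) (F : R^nat -> R) : Prop :=
  forall a b, ell_plus a -> ell_plus b ->
    F (fun i => a i + b i) <= F a + F b.

Definition vanishes_only_at0 (R : realType) (F : R^nat -> R) : Prop :=
  forall a, ell_plus a -> (F a = 0 <-> a = (fun=> 0)).

Definition dist_seq (R : realType) (S : Type) (d_ : nat -> pseudometric R S)
    (x y : S) : R^nat :=
  fun i => d_ i x y.

(* Main.v *)
Require Import Defs.
From HB Require Import structures.
From mathcomp Require Import all_boot all_order all_algebra.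
From mathcomp Require Import all_classical all_reals all_analysis.

(** The proof rests on comparing balls: [d x y < F (e e_i)] forces [d_i x y < e]
    by monotonicity, and under the two limit conditions there are, for each
    [e > 0], some [j] and [r > 0] such that [d_i x y < r] for all [i <= j] forces
    [d x y < e], because subadditivity bounds [d] by the contribution of the
    first [j + 1] pseudometrics plus a uniformly small tail. *)

Set Implicit Arguments.
Unset Strict Implicit.
Unset Printing Implicit Defensive.

Import Order.TTheory GRing.Theory Num.Theory.
Import numFieldNormedType.Exports.

Local Open Scope classical_set_scope.
Local Open Scope ring_scope.

(** * Topological notions expressed through distances *)

Section pmspace_characterizations.
Context (R : realType) (S : Type).
Implicit Types (d : pseudometric R S) (u : nat -> S) (x : S) (A : set S).

Lemma nbhs_pmspaceP d x A :
  nbhs (x : pmspace d) (A : set (pmspace d)) <->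
  exists2 e : R, 0 < e & forall y, d x y < e -> A y.
Proof.
split=> [/nbhs_ballP[e /= e0 xeA]|[e e0 xeA]].
  by exists e => // y xy; apply: xeA.
by apply/nbhs_ballP; exists e => //= y; exact: xeA.
Qed.

Lemma converges_toP d u x :
  converges_to d u x <->
  forall e : R, 0 < e -> \forall n \near \oo, d x (u n) < e.
Proof.
split=> [ux e e0|ux A /nbhs_pmspaceP[e e0 xeA]].
  by apply: (ux [set y | d x y < e]); apply/nbhs_pmspaceP; exists e.
by apply: filterS (ux e e0) => n; exact: xeA.
Qed.

(** Centring the condition at [u N] makes it an eventual statement about the single index [N], so
    that finitely many such conditions can be intersected; halving the radius recovers the two-sided
    form. *)
Lemma cauchy_seqP d u :
  cauchy_seq d u <->
  forall e : R, 0 < e ->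
    \forall N \near \oo, forall n, (N <= n)%N -> d (u N) (u n) < e.
Proof.
split=> [/cauchy_ballP uC e e0|uC].
  have [[P Q] /= [[N1 _ N1P] [N2 _ N2Q]] PQ] := uC _ e0.
  exists (maxn N1 N2) => // n /=; rewrite geq_max => /andP[N1n N2n] m nm.
  by apply: (PQ (u n, u m)); split; [exact: N1P|apply: N2Q; exact: leq_trans nm].
apply/cauchy_ballP => e e0.
have e20 : 0 < e / 2 by rewrite divr_gt0.
have [N _ /(_ N (leqnn N)) uN] := uC _ e20.
exists ([set y | d (u N) y < e / 2], [set y | d (u N) y < e / 2]).
  by split; exists N.
move=> [y z] [/= Ny Nz]; rewrite /ball/= (splitr e).
by rewrite (le_lt_trans (pdist_triangle d (u N) y z))// ltrD// pdist_sym.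
Qed.

Lemma finer_topologyP d d' :
  finer_topology d d' <->
  forall x (e : R), 0 < e ->
    exists2 r : R, 0 < r & forall y, d x y < r -> d' x y < e.
Proof.
split=> [dd' x e e0|dd' A]; last first.
  rewrite !openE => Ao x /Ao /nbhs_pmspaceP[e e0 xeA].
  have [r r0 re] := dd' x e e0.
  by apply/nbhs_pmspaceP; exists r => // y /re /xeA.
pose B : set (pmspace d') := [set y | d' x y < e].
have Bx : nbhs (x : pmspace d') B by apply/nbhs_pmspaceP; exists e.
(* The hypothesis speaks of open sets only, so it is applied to the interior of the ball [B]
   relative to [d']. *)
have /nbhs_pmspaceP[r r0 rB] : nbhs (x : pmspace d) (B° : set (pmspace d)).
  by apply: open_nbhs_nbhs; split; [exact/dd'/open_interior|exact: Bx].
by exists r => // y /rB; exact: (@interior_subset (pmspace d')).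
Qed.

Lemma finer_topology_nat_le (d_ : nat -> pseudometric R S) i j :
  (forall k, finer_topology (d_ k.+1) (d_ k)) -> (i <= j)%N ->
  finer_topology (d_ j) (d_ i).
Proof.
move=> fd /subnK <-; elim: (j - i)%N => [|k IH] A //.
by move=> /IH /fd.
Qed.

Lemma dense_inP d A :
  dense_in d A <->
  forall x (e : R), 0 < e -> exists2 y, A y & d x y < e.
Proof.
split=> [Ad x e e0|Ad U [x Ux]].
  pose B : set (pmspace d) := [set y | d x y < e].
  have [||y [xy Ay]] := Ad B°.
  - by exists x; apply/nbhs_pmspaceP; exists e.
  - exact: open_interior.
  by exists y => //; exact: (@interior_subset (pmspace d)) xy.
rewrite openE => /(_ _ Ux)/nbhs_pmspaceP[e e0 xeU].
by have [y Ay xy] := Ad x e e0; exists y; split=> //; exact: xeU.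
Qed.

Lemma finer_dense_in d d' A :
  finer_topology d d' -> dense_in d A -> dense_in d' A.
Proof. by move=> fd Ad U U0 /fd; exact: Ad. Qed.

End pmspace_characterizations.

(** * Finitely many radii and truncated sequences *)

Lemma exists_pos_lower_bound (R : realType) (P : nat -> R -> Prop) (n : nat) :
  (forall i r s, s <= r -> P i r -> P i s) ->
  (forall i, exists2 r, 0 < r & P i r) ->
  exists2 r, 0 < r & forall i, (i <= n)%N -> P i r.
Proof.
move=> Ple Pex; elim: n => [|n [r r0 rP]].
  by have [r r0 Pr] := Pex 0; exists r => // -[].
(* The smaller radius serves all indices, since each [P i] passes to smaller radii. *)
have [s s0 Ps] := Pex n.+1; exists (Num.min r s); first by rewrite lt_min r0.
move=> i; rewrite leq_eqVlt => /orP[/eqP->|/rP Pi].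
  by apply: Ple Ps; rewrite ge_min lexx orbT.
by apply: Ple Pi; rewrite ge_min lexx.
Qed.

Lemma fin_seqE (R : realType) (j : nat) (a : R^nat) (k : nat) :
  fin_seq (\row_(i < j) a i) k = if (k < j)%N then a k else 0.
Proof.
rewrite /fin_seq /basis_seq; case: ltnP => [kj|jk].
  rewrite (bigD1 (Ordinal kj))//= big1 ?addr0 ?mxE ?eqxx ?mulr1// => i ik.
  by rewrite (_ : (k == i) = false) ?mulr0// eq_sym; exact/negbTE.
by apply: big1 => i _; rewrite gtn_eqF ?mulr0// (leq_trans _ jk).
Qed.

(** * The pseudometric induced by [F] *)

Section induced_pseudometric.
Context (R : realType) (S : Type) (F : R^nat -> R).
Hypotheses (F_ge0 : nonneg_on_ell F) (F_incr : increasing_on_ell F).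
Hypotheses (F_subadd : subadditive_on_ell F) (F_eq0 : vanishes_only_at0 F).
Variable d_ : nat -> pseudometric R S.
Implicit Types x y z : S.

Lemma dist_seq_ell x y : ell_plus (dist_seq d_ x y).
Proof. by move=> i; exact: pdist_ge0. Qed.

Let dist x y := F (dist_seq d_ x y).

Let dist_ge0 x y : 0 <= dist x y.
Proof. exact/F_ge0/dist_seq_ell. Qed.

Let distxx x : dist x x = 0.
Proof.
apply/(F_eq0 (dist_seq_ell x x)); apply/funext => i; exact: pdistxx.
Qed.

Let dist_sym x y : dist x y = dist y x.
Proof. by congr F; apply/funext => i; exact: pdist_sym. Qed.

(** Monotonicity carries the entrywise triangle inequalities through [F], and subadditivity splits
    the resulting sum. *)
Let dist_triangle y x z : dist x z <= dist x y + dist y z.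
Proof.
apply: (le_trans _ (F_subadd (dist_seq_ell x y) (dist_seq_ell y z))).
apply: F_incr => [||i]; first exact: dist_seq_ell.
  by move=> i; rewrite addr_ge0// pdist_ge0.
exact: pdist_triangle.
Qed.

Definition induced_pseudometric : pseudometric R S :=
  Pseudometric dist_ge0 distxx dist_sym dist_triangle.

Local Notation d := induced_pseudometric.

Lemma induced_is_metric :
  is_metric d <-> forall x y, dist_seq d_ x y = (fun=> 0) -> x = y.
Proof.
by split=> dm x y /(F_eq0 (dist_seq_ell x y)); exact: dm.
Qed.

Lemma induced_dominates i (e : R) : 0 < e ->
  exists2 r : R, 0 < r & forall x y, d x y < r -> d_ i x y < e.
Proof.
(* The sequence [a] is [e] times the [i]th basis vector. It is nonzero, so [F a] is positive and can
   be the radius, the same for all points. *)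
move=> e0; pose a : R^nat := fun k => if k == i then e else 0.
have a_ell : ell_plus a by move=> k; rewrite /a; case: ifP => // _; exact: ltW.
exists (F a).
  rewrite lt_def F_ge0// andbT; apply/eqP => /(F_eq0 a_ell)/(congr1 (@^~ i)).
  by rewrite /a eqxx => /eqP; rewrite gt_eqF.
(* If [d_ i x y] is at least [e], then [a] lies entrywise below the sequence of distances. *)
move=> x y; apply: contraTT; rewrite -!leNgt => ed.
apply: F_incr => //; first exact: dist_seq_ell.
by move=> k; rewrite /a; case: eqP => [->|_]; [exact: ed|exact: pdist_ge0].
Qed.

Lemma induced_finer i : finer_topology d (d_ i).
Proof.
apply/finer_topologyP => x e e0.
by have [r r0 re] := induced_dominates i e0; exists r => // y; exact: re.
Qed.

(** * Consequences of the two limit conditions *)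

Hypothesis F_cvg0 : forall j : nat,
  F (fin_seq v) @[v --> within (@nonneg_orthant R j.+1)
                               (nbhs (0 : 'rV[R]_j.+1))] --> (0 : R).
Hypothesis F_tail : ereal_sup [set (F (tail_seq j (dist_seq d_ xy.1 xy.2)))%:E
  | xy in [set: S * S]] @[j --> \oo] --> (0 : \bar R)%E.

Lemma induced_dominated (e : R) : 0 < e ->
  exists j, exists2 r : R, 0 < r &
    forall x y, (forall i, (i <= j)%N -> d_ i x y < r) -> d x y < e.
Proof.
move=> e0; have e20 : 0 < e / 2 by rewrite divr_gt0.
pose tail_sup j : \bar R :=
  ereal_sup [set (F (tail_seq j (dist_seq d_ xy.1 xy.2)))%:E
            | xy in [set: S * S]].
(* All tails starting at [N] or later contribute less than [e / 2], uniformly in the two points. The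
   cut is made at [N.+1], so that the head is a row vector of positive length, as in [F_cvg0]. *)
have [N _ tailN] : \forall j \near \oo, (tail_sup j < (e / 2)%:E)%E.
  have F_tail' : tail_sup @ \oo --> (0 : \bar R)%E := F_tail.
  by apply: (F_tail' [set t | (t < (e / 2)%:E)%E]); exact: open_ereal_lt'.
have := F_cvg0 N => /cvgrPdist_lt/(_ _ e20).
(* Balls of row vectors are entrywise, so the head lies in the ball of radius [r] around 0 once each
   of its distances is below [r]. *)
rewrite near_withinE => /nbhs_ballP[r /= r0 Fr].
exists N, r => // x y xyr; pose v := \row_(i < N.+1) d_ i x y.
have tail_ell : ell_plus (tail_seq N.+1 (dist_seq d_ x y)).
  by move=> k; rewrite /tail_seq; case: ifP => // _; exact: pdist_ge0.
have vE := fin_seqE N.+1 (dist_seq d_ x y).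
have fin_ell : ell_plus (fin_seq v).
  by move=> k; rewrite vE; case: ifP => // _; exact: pdist_ge0.
have splitd : dist_seq d_ x y =
    (fun i => fin_seq v i + tail_seq N.+1 (dist_seq d_ x y) i).
  apply/funext => k; rewrite vE /tail_seq ltnNge -ltnS.
  by case: ltnP; rewrite ?addr0 ?add0r.
rewrite /= /dist splitd (le_lt_trans (F_subadd fin_ell tail_ell))//.
rewrite (splitr e) ltrD//.
  have := Fr v; rewrite sub0r normrN ger0_norm ?F_ge0//; apply.
    split=> // i k; rewrite /ball/= !mxE sub0r normrN ger0_norm ?pdist_ge0//.
    by apply: xyr; rewrite -ltnS.
  by move=> i; rewrite mxE; exact: pdist_ge0.
rewrite -lte_fin (le_lt_trans _ (tailN N.+1 (leqnSn N)))//.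
by apply: ereal_sup_ubound; exists (x, y).
Qed.

Lemma induced_converges_toP u x :
  converges_to d u x <-> forall i, converges_to (d_ i) u x.
Proof.
split=> [/converges_toP ux i|ux]; apply/converges_toP => e e0.
  have [r r0 re] := induced_dominates i e0.
  by apply: filterS (ux r r0) => n; exact: re.
have [j [r r0 rP]] := induced_dominated e0.
(* Only the indices up to [j] matter; ranging over ['I_j.+1] makes this a finite intersection of
   eventual conditions. *)
have : \forall n \near \oo, forall i : 'I_j.+1, d_ i x (u n) < r.
  by apply: filter_forall => i; have /converges_toP := ux i; exact.
by apply: filterS => n ur; apply: rP => i ij; exact: (ur (Ordinal (ij : i < j.+1)%N)).
Qed.

Lemma induced_cauchy_seqP u :
  cauchy_seq d u <-> forall i, cauchy_seq (d_ i) u.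
Proof.
split=> [/cauchy_seqP uC i|uC]; apply/cauchy_seqP => e e0.
  have [r r0 re] := induced_dominates i e0.
  by apply: filterS (uC r r0) => N uN n Nn; exact/re/uN.
have [j [r r0 rP]] := induced_dominated e0.
have : \forall N \near \oo, forall i : 'I_j.+1,
    forall n, (N <= n)%N -> d_ i (u N) (u n) < r.
  by apply: filter_forall => i; have /cauchy_seqP := uC i; exact.
apply: filterS => N ur n Nn; apply: rP => i ij.
exact: (ur (Ordinal (ij : i < j.+1)%N)).
Qed.

(** Completeness of each [d_ i] yields a limit that may depend on [i]; the first premise supplies a
    common one. *)
Lemma induced_complete :
  (forall u, (forall i, converges (d_ i) u) ->
     exists x, forall i, d_ i (u n) x @[n --> \oo] --> (0 : R)) ->
  (forall i, complete_pm (d_ i)) -> complete_pm d.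
Proof.
move=> common_lim d_complete u /induced_cauchy_seqP uC.
have [i|x ux] := common_lim u; first exact: d_complete.
exists x; apply/induced_converges_toP => i; apply/converges_toP => e e0.
have /cvgrPdist_lt/(_ _ e0) := ux i; apply: filterS => n.
by rewrite sub0r normrN ger0_norm ?pdist_ge0// pdist_sym.
Qed.

(** Near a fixed [x], closeness in [d_ j] forces closeness in every [d_ i] with [i <= j], and these
    control [d]. Hence a suitable point of [A j] alone approximates [x]. *)
Lemma induced_dense_in_bigcup (A : nat -> set S) :
  (forall i, finer_topology (d_ i.+1) (d_ i)) ->
  (forall i, dense_in (d_ i) (A i)) -> dense_in d (\bigcup_i A i).
Proof.
move=> fd Ad; apply/dense_inP => x e e0.
have [j [r r0 rP]] := induced_dominated e0.
(* The premise [i <= j] inside [P] makes it vacuous for larger [i], where the radius 1 is an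
   arbitrary choice. *)
pose P i s := (i <= j)%N -> forall y, d_ j x y < s -> d_ i x y < r.
have [|i|s s0 sP] := @exists_pos_lower_bound R P j.
- by move=> i s t ts Ps ij y xyt; apply: Ps => //; exact: lt_le_trans ts.
- have [ij|ij] := leqP i j; last by exists 1 => //; rewrite /P leqNgt ij.
  have /finer_topologyP/(_ x r r0)[s s0 sr] := finer_topology_nat_le fd ij.
  by exists s => // _.
have /dense_inP/(_ x s s0)[y Ay xys] := Ad j.
by exists y; [exists j|apply: rP => i ij; exact: (sP i)].
Qed.

End induced_pseudometric.

Theorem proposition4p5 (R : realType) (S : Type) (S_nonempty : inhabited S)
    (F : R^nat -> R)
    (F_ge0 : nonneg_on_ell F)
    (F_incr : increasing_on_ell F)
    (F_subadd : subadditive_on_ell F)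
    (F_eq0 : vanishes_only_at0 F)
    (d_ : nat -> pseudometric R S) :
  exists d : pseudometric R S,
    [/\ forall x y : S, d x y = F (dist_seq d_ x y),
        is_metric d <->
          (forall x y : S, dist_seq d_ x y = (fun=> 0) -> x = y),
        forall i : nat, finer_topology d (d_ i) &
        (forall j : nat,
           F (fin_seq v) @[v --> within (@nonneg_orthant R j.+1)
                                        (nbhs (0 : 'rV[R]_j.+1))]
             --> (0 : R)) ->
        ereal_sup [set (F (tail_seq j (dist_seq d_ xy.1 xy.2)))%:E
                  | xy in [set: S * S]] @[j --> \oo] --> (0 : \bar R)%E ->
        [/\
            forall u : nat -> S,
              converges d u <->
                exists x : S, forall i : nat, converges_to (d_ i) u x,
            forall u : nat -> S,
              cauchy_seq d u <-> forall i : nat, cauchy_seq (d_ i) u,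
            (forall u : nat -> S,
               (forall i : nat, converges (d_ i) u) ->
               exists x : S, forall i : nat,
                 d_ i (u n) x @[n --> \oo] --> (0 : R)) ->
            (forall i : nat, complete_pm (d_ i)) -> complete_pm d &
            (separable d ->
               (forall i : nat, separable (d_ i)) /\
               (exists2 A : set S,
                  countable A & forall i : nat, dense_in (d_ i) A)) /\
            ((forall i : nat, finer_topology (d_ i.+1) (d_ i)) ->
             (forall i : nat, separable (d_ i)) -> separable d)]].
Proof.
exists (induced_pseudometric F_ge0 F_incr F_subadd F_eq0 d_); split => //.
- exact: induced_is_metric.
- exact: induced_finer.
move=> F_cvg0 F_tail; split.
- by move=> u; split=> -[x /induced_converges_toP ux]; exists x; apply: ux.
- by move=> u; exact: induced_cauchy_seqP.
- exact: induced_complete.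
split=> [[A Ac Ad]|fd sep].
  (* The same set [A] stays dense for every coarser topology, which settles both claims at once. *)
  have Ad_ i : dense_in (d_ i) A by apply: finer_dense_in Ad; exact: induced_finer.
  by split=> [i|]; exists A.
(* Dense sets are chosen for all [i] simultaneously; their union remains countable. *)
have {sep}/choice[A Aj] : forall i, exists A, countable A /\ dense_in (d_ i) A.
  by move=> i; have [A] := sep i; exists A.
exists (\bigcup_i A i); first by apply: bigcup_countable => // i _; case: (Aj i).
by apply: induced_dense_in_bigcup => // i; case: (Aj i).
Qed.
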